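(* Let $G$ be a group with finite generating set $X$, put $A = X\cup X^{-1}$, and assume that $G$ is short-lex automatic with respect to $X$ (for a fixed total order on $A$). Consider the following procedure (all notation is explained in the context), which constructs finite subsets $\mathcal{WD}_1\subseteq \mathcal{WD}_2\subseteq\cdots$ of $G$ and languages $L(WD_n), L(GE_n), L(GW_n), L(T_n)$ for $n = 1,2,\dots$: Start with $\mathcal{WD}_1=\mathcal{D}_M$. Given $\mathcal{WD}_n$, let $WD_n$ be the word-difference automaton associated with $\mathcal{WD}_n$ with $1_G$ as its only accepting state, and define $$L(GE_n)=\{(u,v)\in A^{*}\times A^{*} \mid (u,v)\in L(WD_n),\ v\in L(W),\ l(u)=l(v)\},$$ $$L(GW_n)=\{u\in A^{*}\mid \exists v\in A^{*}:\ (u,v)\in L(GE_n)\},$$ $$L(T_n)=\{w\in A^{*}\setminus L(GW_n)\mid \exists u:\ (w,u)\in L(WD_n),\ u\in L(GW_n),\ l(u)=l(w)\}.$$ If $L(T_n)=\emptyset$, the procedure halts. Otherwise choose a word $w\in L(T_n)$, let $v\in L(W)$ be its short-lex least representative (so $v=_G w$), let $\mathcal{WD}_{n+1}$ be the union of $\mathcal{WD}_n$ and the set of word-differences arising from $(w,v)$, and continue with $n+1$ in place of $n$. Then this procedure halts (i.e. $L(T_n)=\emptyset$ for some $n\geq 1$) if and only if $G$ is strongly geodesically automatic with respect to $X$.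
   Context: Words. $A^{*}$ is the set of words in $A$; for $u\in A^{*}$, $\overline{u}$ is its image in $G$, $u=_G v$ means $\overline{u}=\overline{v}$, $l(u)$ is the length of $u$, and $u(i)$ is the prefix of $u$ of length $i$, with $u(i)=u$ for $i\ge l(u)$. A word $u$ is geodesic if it has minimal length among all words representing $\overline{u}$. Padding. Let $\$$ be an extra symbol, mapping to $1_G$, and $A^\dagger=A\cup\{\$\}$. For $u,v\in A^{*}$, $(u,v)^\dagger\in (A^\dagger\times A^\dagger)^{*}$ is the pair obtained by appending symbols $\$$ to the end of the shorter of $u,v$ so that both have equal length. Two-variable automata read such padded pairs; $(u,v)\in L(M)$ means that $M$ accepts $(u,v)^\dagger$. Automatic structures. $G$ is automatic with respect to $X$ if there are finite state automata $W$ (the word-acceptor, with alphabet $A$, accepting at least one word representing each $g\in G$) and $M_x$ for $x\in A\cup\{1_G\}$ (the multipliers, two-variable) such that $M_x$ accepts $(w_1,w_2)^\dagger$ if and only if $w_1,w_2\in L(W)$ and $w_1x=_G w_2$. The structure is short-lex if $L(W)$ consists exactly of the short-lex least representatives of the elements of $G$ (the lexicographically least, with respect to the fixed total order on $A$, among the shortest words representing the element). $G$ is short-lex automatic with respect to $X$ if such a short-lex structure exists. $G$ is strongly geodesically automatic with respect to $X$ if there is an automatic structure for $G$ with respect to $X$ whose word-acceptor accepts exactly the set of all geodesic words. In the procedure, $W$ and $M_x$ ($x\in A\cup\{1_G\}$) denote the word-acceptor and multipliers of the short-lex automatic structure of $G$. Word-differences. For $u,v\in A^{*}$, the set of word-differences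 arising from $(u,v)$ is $\{\overline{u(i)}^{-1}\overline{v(i)}\mid i\in\mathbb{Z},\ i\ge 0\}$. $\mathcal{D}_M$ is the set of all word-differences arising in the multipliers, i.e. arising from the pairs $(w_1,w_2)$ with $(w_1,w_2)^\dagger$ accepted by some $M_x$, $x\in A\cup\{1_G\}$; it is finite and contains $1_G$. For a subset $\mathcal{D}\subseteq G$ containing $1_G$, the word-difference automaton associated with $\mathcal{D}$ has state set $\mathcal{D}$ (inaccessible states being discarded), initial state $1_G$, and a transition $d\to e$ with label $(x,y)$, for $x,y\in A^\dagger$, whenever $x^{-1}dy=_G e$. Thus, with $1_G$ as only accepting state, it accepts $(u,v)^\dagger$ if and only if $\overline{u}=\overline{v}$ and all word-differences arising from $(u,v)$ lie in $\mathcal{D}$. *)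

(* Defs.v *)
From mathcomp Require Import all_boot finmap.
From mathcomp Require Import boolp classical_sets functions cardinality.

Set Implicit Arguments.
Unset Strict Implicit.
Unset Printing Implicit Defensive.

Local Open Scope classical_set_scope.
Local Open Scope group_scope.

(* Automata have one initial state and a transition relation, which may be
   partial and nondeterministic; finiteness is the separate predicate
   [finite_state]. *)
Record automaton (S : Type) := Automaton {
  state : Type;
  init : state;
  final : set state;
  step : state -> S -> state -> Prop }.

Definition finite_state (S : Type) (M : automaton S) : Prop :=
  finite_set [set: state M].

Fixpoint accepts_from (S : Type) (M : automaton S) (q : state M)
    (s : seq S) : Prop :=
  match s with
  | [::] => final q
  | a :: s' => exists q', step q a q' /\ accepts_from q' s'
  end.

Definition language (S : Type) (M : automaton S) : set (seq S) :=
  [set s | accepts_from (init M) s].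

Definition alphabet (G : groupType) (X : {fset G}) : {fset G} :=
  (X `|` [fset x^-1 | x in X])%fset.

Section Words.
Variables (G : groupType) (A : {fset G}).

Definition ev (u : seq A) : G := \prod_(a <- u) fsval a.

Definition geodesic (u : seq A) : Prop :=
  forall v : seq A, ev v = ev u -> size u <= size v.

(* [None] is the padding symbol $; truncated subtraction makes one of the two
   paddings empty. *)
Definition pad (u v : seq A) : seq (option A * option A) :=
  zip (map Some u ++ nseq (size v - size u) None)
      (map Some v ++ nseq (size u - size v) None).

Definition evd (x : option A) : G := if x is Some a then fsval a else 1.

Definition accepts_pair (M : automaton (option A * option A)) :
  set (seq A * seq A) := [set uv | language M (pad uv.1 uv.2)].

(* Only compared on words of the same length below. *)
Fixpoint lex_le (leA : rel A) (u v : seq A) : bool :=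
  match u, v with
  | [::], _ => true
  | _ :: _, [::] => false
  | a :: u', b :: v' => if a == b then lex_le leA u' v' else leA a b
  end.

Definition shortlex_least (leA : rel A) (u : seq A) : Prop :=
  geodesic u /\
  forall v : seq A, geodesic v -> ev v = ev u -> lex_le leA u v.

(* [M] is a function on all of [G], but only its values on the elements of
   [1 |` A] matter. *)
Definition automatic_structure (W : automaton A)
    (M : G -> automaton (option A * option A)) : Prop :=
  [/\ finite_state W,
      forall g : G, exists u : seq A, language W u /\ ev u = g
    & forall x : G, x \in (1 |` A)%fset ->
        finite_state (M x) /\
        forall w1 w2 : seq A,
          accepts_pair (M x) (w1, w2) <->
          [/\ language W w1, language W w2 & ev w1 * x = ev w2] ].

Definition shortlex_automatic_structure (leA : rel A) (W : automaton A)
    (M : G -> automaton (option A * option A)) : Prop :=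
  automatic_structure W M /\
  forall u : seq A, language W u <-> shortlex_least leA u.

Definition strongly_geodesically_automatic : Prop :=
  exists (W : automaton A) (M : G -> automaton (option A * option A)),
    automatic_structure W M /\
    forall u : seq A, language W u <-> geodesic u.

Definition word_diffs (u v : seq A) : set G :=
  [set d | exists i : nat, d = (ev (take i u))^-1 * ev (take i v)].

Definition multiplier_diffs (M : G -> automaton (option A * option A)) :
  set G :=
  [set d | exists (x : G) (w1 w2 : seq A),
     [/\ x \in (1 |` A)%fset, accepts_pair (M x) (w1, w2) & word_diffs w1 w2 d] ].

(* The states of the word-difference automaton of [D] reachable from [1]; all
   of them lie in [D] when [D] contains [1]. *)
Inductive wd_accessible (D : set G) : G -> Prop :=
  | wd_accessible1 : wd_accessible D 1
  | wd_accessible_step d e (x y : option A) :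
      wd_accessible D d -> D e -> (evd x)^-1 * d * evd y = e ->
      wd_accessible D e.

Definition wd_automaton (D : set G) : automaton (option A * option A) :=
  {| state := {d : G | wd_accessible D d};
     init := exist _ 1 (wd_accessible1 D);
     final := [set q | sval q = 1];
     step := fun q xy q' => (evd xy.1)^-1 * sval q * evd xy.2 = sval q' |}.

Section Procedure.
Variables (W : automaton A) (M : G -> automaton (option A * option A)).

Definition lang_GE (D : set G) : set (seq A * seq A) :=
  [set uv | [/\ accepts_pair (wd_automaton D) uv, language W uv.2
              & size uv.1 = size uv.2] ].

Definition lang_GW (D : set G) : set (seq A) :=
  [set u | exists v : seq A, lang_GE D (u, v)].

Definition lang_T (D : set G) : set (seq A) :=
  [set w | ~ lang_GW D w /\
           exists u : seq A, [/\ accepts_pair (wd_automaton D) (w, u),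
                                 lang_GW D u & size u = size w] ].

Definition procedure_step (D D' : set G) : Prop :=
  exists w v : seq A,
    [/\ lang_T D w, language W v, ev v = ev w
      & D' = D `|` word_diffs w v].

(* A run of the procedure, i.e. one sequence of admissible choices of the words
   [w]. Stages are numbered from 1 ([WD 0] is irrelevant), and the sequence is
   continued as a constant once the procedure has halted. *)
Definition procedure_run (WD : nat -> set G) : Prop :=
  WD 1%N = multiplier_diffs M /\
  forall n : nat, (1 <= n)%N ->
    (lang_T (WD n) = set0 -> WD n.+1 = WD n) /\
    (lang_T (WD n) <> set0 -> procedure_step (WD n) (WD n.+1)).

Definition procedure_halts (WD : nat -> set G) : Prop :=
  exists n : nat, (1 <= n)%N /\ lang_T (WD n) = set0.

End Procedure.
End Words.

(* Main.v *)
(** The word-differences of an automatic structure form a finite set: the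
    word-difference after reading a pair of prefixes is determined by the state
    of the multiplier reached, because it can be recomputed from any accepted
    pair of suffixes.

    If [L(T_n)] is empty, then [L(GW_n)] is the set of all geodesics.  Otherwise
    take a shortest geodesic [w' a] outside [L(GW_n)]; the prefix [w'] is paired
    with its short-lex representative [v'], and [v' a] lies in [L(GW_n)] by the
    multiplier [M_a], so [w' a] lies in [L(T_n)].  Two geodesics [w1], [w2] with
    [w1 x = w2] are then compared through their short-lex representatives, and
    their word-differences lie in the finite set [D D D^-1] where [D = WD_n].

    Conversely, all the words occurring in [L(T_n)] are geodesic, so every
    [WD_n] lies in the union of the word-differences of the two automatic
    structures, a finite set; but [WD_n] strictly grows until the procedure
    halts. *)
Require Import Defs.
From mathcomp Require Import all_boot finmap.
From mathcomp Require Import boolp classical_sets functions cardinality.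

Set Implicit Arguments.
Unset Strict Implicit.
Unset Printing Implicit Defensive.

Local Open Scope classical_set_scope.
Local Open Scope group_scope.

(** * Closure constructions for nondeterministic automata *)

Section Automata.
Variable S : Type.

Fixpoint reaches (M : automaton S) (q : state M) (s : seq S) (r : state M) :
    Prop :=
  if s is a :: s' then exists q', step q a q' /\ reaches q' s' r else q = r.

Lemma accepts_from_cat (M : automaton S) (q : state M) (s t : seq S) :
  accepts_from q (s ++ t) <-> exists r, reaches q s r /\ accepts_from r t.
Proof.
elim: s q => [|a s IHs] q /=; first by split=> [qt|[r [-> //]]]; exists q.
split=> [[q' [qq' /IHs[r [q'r rt]]]]|[r [[q' [qq' q'r]] rt]]].
  by exists r; split=> //; exists q'.
by exists q'; split=> //; apply/IHs; exists r.
Qed.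

Definition inter_automaton (M N : automaton S) : automaton S :=
  {| state := state M * state N;
     init := (init M, init N);
     final := [set q | final q.1 /\ final q.2];
     step := fun q a r => step q.1 a r.1 /\ step q.2 a r.2 |}.

Lemma inter_automaton_finite (M N : automaton S) :
  finite_state M -> finite_state N -> finite_state (inter_automaton M N).
Proof. by move=> finM finN; rewrite /finite_state -setXTT; exact: finite_setX. Qed.

Lemma language_inter (M N : automaton S) (s : seq S) :
  language (inter_automaton M N) s <-> language M s /\ language N s.
Proof.
have: forall q, accepts_from (M := inter_automaton M N) q s <->
    accepts_from q.1 s /\ accepts_from q.2 s; last exact.
elim: s => [|a s IHs] [q r] //=; split=> [[[q' r'] [[/= qq' rr'] /IHs[/= q's r's]]]|].
  by split; [exists q' | exists r'].
by case=> [[q' [qq' q's]] [r' [rr' r's]]]; exists (q', r'); split=> //; apply/IHs.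
Qed.

(* The automaton reading the image of its input under [f], where letters sent
   to [None] are skipped. *)
Definition pmap_automaton (T : Type) (f : T -> option S) (M : automaton S) :
    automaton T :=
  {| state := state M;
     init := init M;
     final := @final _ M;
     step := fun q b r => if f b is Some a then step q a r else q = r |}.

Lemma language_pmap (T : Type) (f : T -> option S) (M : automaton S)
    (s : seq T) :
  language (pmap_automaton f M) s <-> language M (pmap f s).
Proof.
have: forall q, accepts_from (M := pmap_automaton f M) q s <->
    accepts_from (M := M) q (pmap f s); last exact.
elim: s => [|b s IHs] q //=; case: (f b) => [a|] /=.
  by split=> -[r [qr /IHs rs]]; exists r.
by split=> [[r [-> /IHs //]]|qs]; exists q; split=> //; apply/IHs.
Qed.

(** Nondeterminism guesses the erased track letter by letter; this realises the existential
    quantifier in [lang_GW]. *)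
Definition proj_automaton (T : Type) (M : automaton (S * T)) : automaton S :=
  {| state := state M;
     init := init M;
     final := @final _ M;
     step := fun q a r => exists b : T, step q (a, b) r |}.

Lemma language_proj (T : Type) (M : automaton (S * T)) (s : seq S) :
  language (proj_automaton M) s <->
  exists t : seq T, size t = size s /\ language M (zip s t).
Proof.
have: forall q, accepts_from (M := proj_automaton M) q s <->
    exists t, size t = size s /\ accepts_from (M := M) q (zip s t); last exact.
elim: s => [|a s IHs] q /=.
  by split=> [qf|[[|b t] []//]]; exists [::].
split=> [[r [[b qr] /IHs[t [szt rt]]]]|[[|b t] [//= szt [r [qr rt]]]]].
  by exists (b :: t); split; [rewrite /= szt | exists r].
by exists r; split; [exists b | apply/IHs; exists t; case: szt].
Qed.

End Automata.

Lemma pmap_map (S T U : Type) (f : S -> T) (g : T -> option U) (s : seq S) :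
  pmap g (map f s) = pmap (g \o f) s.
Proof. by elim: s => //= x s ->. Qed.

Lemma pmap_Some_map (S T : Type) (f : S -> T) (s : seq S) :
  pmap (fun x => Some (f x)) s = map f s.
Proof. by elim: s => //= x s ->. Qed.

Lemma zip_map2 (S T S' T' : Type) (f : S -> S') (g : T -> T') (s : seq S) (t : seq T) :
  zip (map f s) (map g t) = map (fun ab => (f ab.1, g ab.2)) (zip s t).
Proof. by elim: s t => [|a s IHs] [|b t] //=; rewrite IHs. Qed.

(** States of word-difference automata are elements bundled with an accessibility proof; proof
    irrelevance makes [sval] injective on them. *)
Lemma finite_sig (T : Type) (P : set T) :
  finite_set P -> finite_set [set: {x | P x}].
Proof.
move=> finP.
have -> : [set: {x | P x}] = sval @^-1` P.
  by apply/seteqP; split=> // x _; exact: (svalP x).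
apply: finite_preimage => // -[x Px] [y Py] _ _ /= xy.
by subst y; congr exist; exact: Prop_irrelevance.
Qed.

Lemma subsingleton_finite (T : Type) (P : set T) :
  (forall x y, P x -> P y -> x = y) -> finite_set P.
Proof.
move=> Psub; have [->|/set0P[x Px]] := eqVneq P set0.
  exact: finite_set0.
by apply: sub_finite_set (finite_set1 x) => y Py; exact: Psub.
Qed.

(** * Geodesics, padded pairs and word-differences *)

Section WordDifferences.
Variables (G : groupType) (A : {fset G}).
Implicit Types (u v w : seq A) (D : set G).

Lemma ev_cat u v : ev (u ++ v) = ev u * ev v.
Proof. by rewrite /ev big_cat. Qed.

Lemma geodesic_size u v : geodesic u -> geodesic v -> ev u = ev v -> size u = size v.
Proof. by move=> gu gv uv; apply/eqP; rewrite eqn_leq gu ?gv. Qed.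

Lemma geodesic_eq_size u v : geodesic u -> ev v = ev u -> size v = size u -> geodesic v.
Proof. by move=> gu vu szv w; rewrite vu szv; exact: gu. Qed.

Lemma geodesic_catl u v : geodesic (u ++ v) -> geodesic u.
Proof.
move=> guv w wu; have := guv (w ++ v).
by rewrite !ev_cat wu !size_cat leq_add2r; exact.
Qed.

Lemma pad_eq_size u v : size u = size v -> pad u v = zip (map Some u) (map Some v).
Proof. by move=> uv; rewrite /pad uv subnn !cats0. Qed.

Lemma size_pad_components u v :
  size (map Some u ++ nseq (size v - size u) None) =
  size (map Some v ++ nseq (size u - size v) None).
Proof. by rewrite !size_cat !size_map !size_nseq -!maxnE maxnC. Qed.

Lemma pmap_id_pad u k : pmap id (map Some u ++ nseq k None) = u.
Proof.
rewrite pmap_cat map_pK // -[RHS]cats0; congr (_ ++ _).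
by elim: k.
Qed.

Lemma pmap_fst_pad u v : pmap fst (pad u v) = u.
Proof.
rewrite -[pmap _ _](pmap_map fst id) -/(unzip1 _) unzip1_zip ?pmap_id_pad //.
by rewrite size_pad_components.
Qed.

Lemma pmap_snd_pad u v : pmap snd (pad u v) = v.
Proof.
rewrite -[pmap _ _](pmap_map snd id) -/(unzip2 _) unzip2_zip ?pmap_id_pad //.
by rewrite size_pad_components.
Qed.

(** The side conditions forbid extending a word already outrun by the other, since a letter would
    then follow a padding symbol. *)
Lemma pad_cat u1 u2 v1 v2 :
  (size u1 < size v1 -> u2 = [::])%N -> (size v1 < size u1 -> v2 = [::])%N ->
  pad (u1 ++ u2) (v1 ++ v2) = pad u1 v1 ++ pad u2 v2.
Proof.
move=> u2nil v2nil; rewrite /pad -zip_cat; last exact: size_pad_components.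
case: (ltngtP (size u1) (size v1)) => [uv|uv|uv].
- have uv0 : (size u1 - size v1 = 0)%N by apply/eqP; exact: ltnW.
  have uvv0 : (size u1 - (size v1 + size v2) = 0)%N by rewrite subnDA uv0.
  rewrite (u2nil uv) cats0 map_cat size_cat uv0 uvv0 subn0 !cats0 /=.
  by rewrite -addnBAC ?(ltnW uv) // nseqD catA.
- have vu0 : (size v1 - size u1 = 0)%N by apply/eqP; exact: ltnW.
  have vuu0 : (size v1 - (size u1 + size u2) = 0)%N by rewrite subnDA vu0.
  rewrite (v2nil uv) cats0 map_cat size_cat vu0 vuu0 subn0 !cats0 /=.
  by rewrite -addnBAC ?(ltnW uv) // nseqD catA.
- by rewrite !map_cat !size_cat uv !subnDl subnn !cats0 -!catA.
Qed.

(** Generalises the accepting state of [wd_automaton] from [1] to [x], so that the same automaton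
    also yields multipliers; at [x = 1] the two are convertible. *)
Definition diff_automaton D (x : G) : automaton (option A * option A) :=
  {| state := {d : G | wd_accessible A D d};
     init := exist _ 1 (wd_accessible1 A D);
     final := [set q | sval q = x];
     step := fun q xy q' => (evd xy.1)^-1 * sval q * evd xy.2 = sval q' |}.

Lemma wd_accessible_mem D d : D 1 -> wd_accessible A D d -> D d.
Proof. by move=> D1 []. Qed.

Lemma diff_automaton_finite D x : finite_set D -> D 1 -> finite_state (diff_automaton D x).
Proof.
move=> finD D1; apply: finite_sig; apply: sub_finite_set finD => d.
exact: wd_accessible_mem.
Qed.

Definition evs (s : seq (option A)) : G := \prod_(a <- s) evd a.

Lemma evs_pad u k : evs (map Some u ++ nseq k None) = ev u.
Proof.
rewrite /evs big_cat big_map /= -[RHS]mulg1; congr (_ * _).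
by elim: k => [|k IHk]; rewrite /= ?big_nil // big_cons IHk mulg1.
Qed.

Lemma take_pad u k i :
  exists j, take i (map Some u ++ nseq k None) = map Some (take i u) ++ nseq j None.
Proof.
rewrite take_cat size_map; case: ltnP => iu.
  by exists 0%N; rewrite cats0 map_take.
rewrite (take_oversize iu); have [ki|ik] := leqP k (i - size u).
  by exists k; rewrite [X in _ ++ X]take_oversize ?size_nseq.
by exists (i - size u)%N; rewrite take_nseq // ltnW.
Qed.

Lemma evs_take_pad u k i : evs (take i (map Some u ++ nseq k None)) = ev (take i u).
Proof. by have [j ->] := take_pad u k i; rewrite evs_pad. Qed.

(** The label and the current difference force the next one, so a run exists exactly when no forced
    difference leaves [D]. *)
Lemma diff_automaton_accepts_from D x (D1 : D 1)
    (q : state (diff_automaton D x)) (s t : seq (option A)) :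
  size s = size t ->
  accepts_from q (zip s t) <->
  (forall i, D ((evs (take i s))^-1 * sval q * evs (take i t))) /\
  (evs s)^-1 * sval q * evs t = x.
Proof.
elim: s t q => [|a s IHs] [|b t] q //=.
  rewrite /evs big_nil invg1 mul1g mulg1 => _; split=> [qx|[]//].
  split=> // _; exact: wd_accessible_mem (svalP q).
move=> [szst].
have evsE i : (evs (take i.+1 (a :: s)))^-1 * sval q * evs (take i.+1 (b :: t)) =
    (evs (take i s))^-1 * ((evd a)^-1 * sval q * evd b) * evs (take i t).
  by rewrite /evs /= !big_cons invgM !mulgA.
have evsT : (evs (a :: s))^-1 * sval q * evs (b :: t) =
    (evs s)^-1 * ((evd a)^-1 * sval q * evd b) * evs t.
  by rewrite /evs /= !big_cons invgM !mulgA.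
rewrite evsT; split=> [[q' [qq' /(IHs _ _ szst)[Dq' fq']]]|[Dq fq]].
  rewrite qq'; split=> // -[|i]; last by rewrite evsE qq'.
  rewrite /= /evs !big_nil invg1 mul1g mulg1.
  exact: wd_accessible_mem (svalP q).
(* The prefix of length 1 shows that the first forced difference lies in [D], hence is an accessible
   state. *)
have Dq' : D ((evd a)^-1 * sval q * evd b).
  by have := Dq 1%N; rewrite evsE !take0 /evs !big_nil invg1 mul1g mulg1.
exists (exist _ _ (wd_accessible_step (svalP q) Dq' erefl)); split=> //.
by apply/IHs => //=; split=> // i; rewrite -evsE.
Qed.

Lemma accepts_diff_automaton D x u v : D 1 ->
  accepts_pair (diff_automaton D x) (u, v) <->
  word_diffs u v `<=` D /\ ev u * x = ev v.
Proof.
move=> D1; rewrite /accepts_pair /language /=.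
rewrite (diff_automaton_accepts_from _ _ (size_pad_components u v)) //= mulg1 !evs_pad.
split=> -[Duv uvx]; split.
- by move=> _ [i ->]; have := Duv i; rewrite mulg1 !evs_take_pad.
- by rewrite -uvx mulVKg.
- by move=> i; rewrite mulg1 !evs_take_pad; apply: Duv; exists i.
- by rewrite -uvx mulKg.
Qed.

Lemma accepts_wd_automaton D u v : D 1 ->
  accepts_pair (wd_automaton A D) (u, v) <-> word_diffs u v `<=` D /\ ev u = ev v.
Proof. by move=> D1; have := accepts_diff_automaton 1 u v D1; rewrite mulg1. Qed.

Lemma word_diffs_finite u v : finite_set (word_diffs u v).
Proof.
set n := (size u + size v)%N.
apply: (sub_finite_set (B := (fun i => (ev (take i u))^-1 * ev (take i v)) @` `I_n.+1));
  last exact/finite_image/finite_II.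
(* From index [n] on both words are exhausted, so larger indices only repeat the difference at
   [n]. *)
move=> _ [i ->]; have [ni|ni] := leqP n i; last by exists i => //=; exact: ltnW.
have [un vn] : (size u <= n /\ size v <= n)%N by rewrite leq_addr leq_addl.
by exists n => //=; rewrite !take_oversize // (leq_trans _ ni).
Qed.

Lemma word_diffs1 u v : word_diffs u v 1.
Proof. by exists 0%N; rewrite !take0 mulVg. Qed.

Lemma word_diffs_sub_rcons D u v a : D 1 -> size u = size v -> ev u = ev v ->
  word_diffs u v `<=` D -> word_diffs (rcons u a) (rcons v a) `<=` D.
Proof.
move=> D1 szuv uv Duv _ [i ->]; have [iu|iu] := leqP i (size u).
  rewrite -!cats1 !takel_cat -?szuv //; apply: Duv; by exists i.
rewrite !take_oversize ?size_rcons -?szuv // -!cats1 !ev_cat uv mulVg //.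
Qed.

(** Up to the length of [v] the differences are those of [(v, w)]; afterwards both words are
    complete and equal in [G], which contributes only [1]. *)
Lemma word_diffs_rcons_sub D u v w a : size u = size v -> size w = (size u).+1 ->
  ev (rcons u a) = ev w -> word_diffs v w `<=` D -> ev u = ev v ->
  word_diffs (rcons v a) w `<=` D.
Proof.
move=> szuv szw uaw Dvw uv.
have D1 : D 1 by apply: Dvw; exact: word_diffs1.
move=> _ [i ->]; have [iv|iv] := leqP i (size v).
  by rewrite -cats1 takel_cat //; apply: Dvw; exists i.
rewrite !take_oversize ?size_rcons ?szw ?szuv //.
by rewrite -uaw -!cats1 !ev_cat uv mulVg.
Qed.

Lemma take_pair_cases u v i :
  let u1 := take i u in let v1 := take i v in
  (size u1 < size v1 -> drop i u = [::])%N /\ (size v1 < size u1 -> drop i v = [::])%N.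
Proof.
rewrite /= !size_take_min; split=> lt; apply: drop_oversize;
  rewrite leqNgt; apply/negP => gt; move: lt;
  by rewrite (minn_idPl (ltnW gt)) ltnNge geq_minl.
Qed.

(* A word-difference is determined by the multiplier state together with which of
   the two words, if any, is already exhausted: without the latter, exchanging
   suffixes could produce strings that are not paddings of pairs of words. *)
Lemma multiplier_diffs_finite (W : automaton A)
    (M : G -> automaton (option A * option A)) :
  automatic_structure W M -> finite_set (multiplier_diffs M).
Proof.
move=> [_ _ Mx].
(* [P x c] collects the differences seen at state [c.1] when the flags [c.2] tell which prefix, if
   any, is the shorter one. *)
pose P (x : G) (c : state (M x) * (bool * bool)) : set G :=
  [set d | exists u1 u2 v1 v2 : seq A,
    [/\ reaches (init (M x)) (pad u1 v1) c.1, accepts_from c.1 (pad u2 v2),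
        c.2 = (size u1 < size v1, size v1 < size u1)%N,
        (size u1 < size v1 -> u2 = [::])%N /\ (size v1 < size u1 -> v2 = [::])%N
      & d = (ev u1)^-1 * ev v1]].
apply: (sub_finite_set (B := \bigcup_(x in [set` (1 |` A)%fset])
    \bigcup_(c in [set: state (M x) * (bool * bool)]) P x c)).
  move=> d [x [w1 [w2 [Ax acc [i ->]]]]]; exists x => //.
  have cases := take_pair_cases w1 w2 i.
  move: acc; rewrite /accepts_pair /language /= -{1}(cat_take_drop i w1).
  rewrite -{1}(cat_take_drop i w2) pad_cat; [|exact: cases.1|exact: cases.2].
  move=> /accepts_from_cat[q [iq qf]].
  exists (q, (size (take i w1) < size (take i w2), size (take i w2) < size (take i w1))%N) => //.
  by exists (take i w1), (drop i w1), (take i w2), (drop i w2).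
apply: bigcup_finite => [|x Ax]; first exact: finite_fset.
have [finMx MxP] := Mx x Ax.
apply: bigcup_finite => [|[q b] _].
  by rewrite -setXTT; apply: finite_setX => //; exact: finite_finset.
apply: subsingleton_finite => d d'.
move=> [u1 [u2 [v1 [v2 [/= iq qf bE suf ->]]]]].
move=> [u1' [u2' [v1' [v2' [/= iq' qf' bE' suf' ->]]]]].
have [suf1 suf2] : (size u1 < size v1 -> u2' = [::])%N /\ (size v1 < size u1 -> v2' = [::])%N.
  by move: bE'; rewrite bE => -[-> ->].
(* Any prefix pair reaching [q] with compatible flags can be completed by the one fixed suffix pair
   [(u2', v2')]; the multiplier equation then determines its difference. *)
have diffE p1 p2 : (size p1 < size p2 -> u2' = [::])%N -> (size p2 < size p1 -> v2' = [::])%N ->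
    reaches (init (M x)) (pad p1 p2) q -> (ev p1)^-1 * ev p2 = ev u2' * x * (ev v2')^-1.
  move=> s1 s2 ip; have [|_ _] := (MxP (p1 ++ u2') (p2 ++ v2')).1.
    by rewrite /accepts_pair /language /= pad_cat //; apply/accepts_from_cat; exists q.
  rewrite !ev_cat => e; apply: (mulgI (ev p1)); apply: (mulIg (ev v2')).
  by rewrite mulVKg -e !mulgA mulgVK.
rewrite (diffE u1 v1) // (diffE u1' v1') //; [exact: suf'.1 | exact: suf'.2].
Qed.

End WordDifferences.

(** * Halting of the procedure and geodesic automatic structures *)

Section Halting.
Variables (G : groupType) (A : {fset G}).
Implicit Types (u v w : seq A) (D : set G).

Lemma strictly_increasing_not_bounded (F : set G) (WD : nat -> set G) :
  finite_set F -> (forall n, WD n `<=` F) ->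
  ~ (forall n, WD n `<=` WD n.+1 /\ ~ WD n.+1 `<=` WD n).
Proof.
move=> finF WDF incr.
have fin n : finite_set (WD n) by exact: sub_finite_set finF.
(* Each strict inclusion adds at least one element; the stage numbered one more than the cardinality
   of [F] is then too large. *)
have grow n : (n <= #|` fset_set (WD n)|)%N.
  elim: n => // n IHn; apply: leq_ltn_trans IHn _; apply: fproper_ltn_card.
  have [sub nsub] := incr n.
  rewrite fproperE; apply/andP; split; first by rewrite -fset_set_sub.
  by apply/negP; rewrite -fset_set_sub.
have := grow #|` fset_set F|.+1; apply/negP; rewrite -leqNgt.
by apply: fsubset_leq_card; rewrite -fset_set_sub.
Qed.

Variables (W : automaton A) (M : G -> automaton (option A * option A)).
Hypothesis WM : automatic_structure W M.
Hypothesis Wgeo : forall u, language W u -> geodesic u.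

Lemma multiplier_diffs1 : multiplier_diffs M 1.
Proof.
have [_ surj Mx] := WM; have [u [Wu _]] := surj 1.
have A1 : 1 \in (1 |` A)%fset by rewrite in_fset1U eqxx.
exists 1, u, u; split=> //; last exact: word_diffs1.
by apply/(Mx 1 A1).2; split=> //; rewrite mulg1.
Qed.

Lemma word_diffs_multiplier x u v : x \in (1 |` A)%fset -> language W u ->
  language W v -> ev u * x = ev v -> word_diffs u v `<=` multiplier_diffs M.
Proof.
have [_ _ Mx] := WM => Ax Wu Wv uv d duv; exists x, u, v; split=> //.
by apply/(Mx x Ax).2.
Qed.

Lemma mem_lang_GW D u : D 1 ->
  lang_GW W D u <-> exists v, [/\ language W v, size v = size u, ev u = ev v
                                & word_diffs u v `<=` D].
Proof.
move=> D1; split=> [[v [/(accepts_wd_automaton _ _ D1)[Duv uv] Wv szuv]]|].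
  by exists v.
move=> [v [Wv szv uv Duv]]; exists v; split=> //=.
by apply/accepts_wd_automaton.
Qed.

Lemma lang_GW_geodesic D u : D 1 -> lang_GW W D u -> geodesic u.
Proof.
move=> D1 /(mem_lang_GW _ D1)[v [Wv szv uv _]].
exact: geodesic_eq_size (Wgeo Wv) uv _.
Qed.

Lemma lang_T_geodesic D w : D 1 -> lang_T W D w -> geodesic w.
Proof.
move=> D1 [_ [u [/(accepts_wd_automaton _ _ D1)[_ wu] GWu szu]]].
exact: geodesic_eq_size (lang_GW_geodesic D1 GWu) wu _.
Qed.

Lemma geodesic_lang_GW D u : multiplier_diffs M `<=` D -> lang_T W D = set0 ->
  geodesic u -> lang_GW W D u.
Proof.
move=> MD T0; have D1 : D 1 by apply: MD; exact: multiplier_diffs1.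
have [_ surj _] := WM.
elim/last_ind: u => [|w a IHw] gwa.
  have [v [Wv v1]] := surj (ev ([::] : seq A)).
  have szv := geodesic_size (Wgeo Wv) gwa v1.
  by apply/mem_lang_GW => //; exists v; split=> //; rewrite (size0nil szv) => _ [i ->]; rewrite mulVg.
have gw : geodesic w by apply: (@geodesic_catl _ _ _ [:: a]); rewrite cats1.
have /(mem_lang_GW _ D1)[v [Wv szv wv Dwv]] := IHw gw.
(* Both [v] and [z] are accepted by [W] and differ by the generator [a], so the differences of
   [(v, z)] arise in [M a]; hence [rcons v a] lies in [lang_GW W D] with partner [z]. *)
have [z [Wz zE]] := surj (ev (rcons w a)).
have szz : size z = (size w).+1.
  by rewrite (geodesic_size (Wgeo Wz) gwa zE) size_rcons.
have vwa : ev (rcons v a) = ev (rcons w a) by rewrite -!cats1 !ev_cat wv.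
apply: contrapT => GWwa.
suff: lang_T W D (rcons w a) by rewrite T0.
split=> //; exists (rcons v a); split; last by rewrite !size_rcons szv.
  apply/accepts_wd_automaton => //; split=> //.
  exact: word_diffs_sub_rcons.
apply/mem_lang_GW => //; exists z; split=> //.
- by rewrite size_rcons szv.
- by rewrite vwa.
apply: (word_diffs_rcons_sub (u := w)) => //.
apply: subset_trans MD; apply: (@word_diffs_multiplier (fsval a)) => //.
  by rewrite in_fset1U fsvalP orbT.
by rewrite zE -wv -cats1 ev_cat /ev big_seq1.
Qed.

(** The pairs in [lang_GE] have equal lengths, so the automaton can read letters of [A * A] without
    padding before the second track is projected away. *)
Definition GW_automaton D : automaton A :=
  proj_automaton (inter_automaton
    (pmap_automaton (fun ab : A * A => Some (Some ab.1, Some ab.2)) (wd_automaton A D))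
    (pmap_automaton (fun ab : A * A => Some ab.2) W)).

Lemma GW_automaton_finite D : finite_set D -> D 1 -> finite_state (GW_automaton D).
Proof.
move=> finD D1; have [finW _ _] := WM.
apply: inter_automaton_finite => //.
exact: (@diff_automaton_finite _ _ D 1).
Qed.

Lemma language_GW_automaton D u : language (GW_automaton D) u <-> lang_GW W D u.
Proof.
rewrite language_proj; split=> -[v].
  move=> [szv /language_inter[/language_pmap Duv /language_pmap Wv]].
  exists v; split=> //=; last first.
    by move: Wv; rewrite pmap_Some_map -/(unzip2 _) unzip2_zip ?szv.
  move: Duv; rewrite pmap_Some_map /accepts_pair /= pad_eq_size //.
  by rewrite zip_map2.
move=> [Duv Wv /= szuv]; exists v; split=> //.
apply/language_inter; split; apply/language_pmap; rewrite pmap_Some_map.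
  by move: Duv; rewrite /accepts_pair /= pad_eq_size // zip_map2.
by rewrite -/(unzip2 _) unzip2_zip ?szuv.
Qed.

Lemma halted_strongly_geodesically_automatic D : finite_set D ->
  multiplier_diffs M `<=` D -> lang_T W D = set0 -> strongly_geodesically_automatic A.
Proof.
move=> finD MD T0; have D1 : D 1 by apply: MD; exact: multiplier_diffs1.
have [_ surj _] := WM.
pose N := GW_automaton D.
have NP u : language N u <-> geodesic u.
  rewrite language_GW_automaton; split; first exact: lang_GW_geodesic.
  exact: geodesic_lang_GW.
(* The three factors bound the differences along the chain [w1], [v1], [v2], [w2], where [v1] and
   [v2] are the partners of [w1] and [w2] in [L(W)]. *)
pose E : set G := [set x * y | x in [set x * y | x in D & y in D] & y in [set x^-1 | x in D]].
have finE : finite_set E.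
  by apply: finite_image2; [exact: finite_image2 | exact: finite_image].
have EM x y z : D x -> D y -> D z -> E (x * y * z^-1).
  by move=> Dx Dy Dz; exists (x * y); [exists x => //; exists y | exists z^-1 => //; exists z].
have E1 : E 1 by have := EM 1 1 1 D1 D1 D1; rewrite invg1 !mulg1.
exists N, (fun x => inter_automaton (pmap_automaton fst N)
  (inter_automaton (pmap_automaton snd N) (diff_automaton A E x))); split=> //; split.
- exact: GW_automaton_finite.
- by move=> g; have [u [Wu <-]] := surj g; exists u; split=> //; apply/NP/Wgeo.
move=> x Ax; split.
  have finN : finite_state N by exact: GW_automaton_finite.
  do 2![apply: inter_automaton_finite => //].
  exact: diff_automaton_finite.
move=> w1 w2; rewrite /accepts_pair /= !language_inter !language_pmap.
rewrite pmap_fst_pad pmap_snd_pad.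
rewrite -[language (diff_automaton _ _ _) _]/(accepts_pair _ (w1, w2)).
rewrite accepts_diff_automaton //.
split=> [[Nw1 [Nw2 [_ w12]]] //|[Nw1 Nw2 w12]]; do 3![split=> //].
have /language_GW_automaton/(mem_lang_GW _ D1)[v1 [Wv1 _ wv1 D1v]] := Nw1.
have /language_GW_automaton/(mem_lang_GW _ D1)[v2 [Wv2 _ wv2 D2v]] := Nw2.
have D12 : word_diffs v1 v2 `<=` D.
  by apply: subset_trans MD; apply: (word_diffs_multiplier Ax); rewrite // -wv1 -wv2.
move=> _ [i ->].
(* Telescoping through the prefixes of [v1] and [v2]; the last factor is inverted because [D2v]
   concerns [(w2, v2)]. *)
have -> : (ev (take i w1))^-1 * ev (take i w2) =
  ((ev (take i w1))^-1 * ev (take i v1)) * ((ev (take i v1))^-1 * ev (take i v2)) *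
  ((ev (take i w2))^-1 * ev (take i v2))^-1.
  by rewrite invgM invgK !mulgA mulgK mulgK.
by apply: EM; [apply: D1v | apply: D12 | apply: D2v]; exists i.
Qed.

(** * Growth and boundedness of the runs *)

Variable WD : nat -> set G.
Hypothesis run : procedure_run W M WD.

(** Stages start at 1 and [WD 0] is arbitrary, hence the index shift here and below. *)
Lemma procedure_run_sub n : WD n.+1 `<=` WD n.+2.
Proof.
have [run0 runS] := run.2 n.+1 isT.
have [/run0 -> //|/eqP/runS[w [v [_ _ _ ->]]]] := eqVneq (lang_T W (WD n.+1)) set0.
exact: subsetUl.
Qed.

Lemma procedure_run_ge n : multiplier_diffs M `<=` WD n.+1.
Proof.
elim: n => [|n IHn]; first by rewrite run.1.
exact: subset_trans IHn (@procedure_run_sub n).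
Qed.

Lemma procedure_run1 n : WD n.+1 1.
Proof. exact/procedure_run_ge/multiplier_diffs1. Qed.

Lemma procedure_run_finite n : finite_set (WD n.+1).
Proof.
elim: n => [|n IHn]; first by rewrite run.1; exact: multiplier_diffs_finite WM.
have [run0 runS] := run.2 n.+1 isT.
have [/run0 -> //|/eqP/runS[w [v [_ _ _ ->]]]] := eqVneq (lang_T W (WD n.+1)) set0.
by rewrite finite_setU; split=> //; exact: word_diffs_finite.
Qed.

(** If nothing new were added, the representative [v] would already witness that the chosen [w] lies
    in [lang_GW], contrary to [lang_T]. *)
Lemma procedure_run_proper n : lang_T W (WD n.+1) <> set0 -> ~ WD n.+2 `<=` WD n.+1.
Proof.
move=> /(run.2 n.+1 isT).2[w [v [Tw Wv vw ->]]] sub.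
have D1 := procedure_run1 n.
apply: Tw.1; apply/mem_lang_GW => //; exists v; split=> //.
  by apply: geodesic_size vw; [exact: Wgeo | exact: lang_T_geodesic Tw].
by move=> d dwv; apply: sub; right.
Qed.

(** The chosen word and its representative are both geodesic and equal in [G], so [M' 1] accepts the
    pair and every added difference arises in [M']. *)
Lemma procedure_run_bounded (W' : automaton A) (M' : G -> automaton (option A * option A)) n :
  automatic_structure W' M' -> (forall u, language W' u <-> geodesic u) ->
  WD n.+1 `<=` multiplier_diffs M `|` multiplier_diffs M'.
Proof.
move=> [_ _ Mx'] W'P.
elim: n => [|n IHn]; first by rewrite run.1; exact: subsetUl.
have [run0 runS] := run.2 n.+1 isT.
have [/run0 -> //|/eqP/runS[w [v [Tw Wv vw ->]]]] := eqVneq (lang_T W (WD n.+1)) set0.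
have A1 : 1 \in (1 |` A)%fset by rewrite in_fset1U eqxx.
rewrite subUset; split=> // d dwv; right; exists 1, w, v; split=> //.
apply/(Mx' 1 A1).2; split; last by rewrite mulg1.
  exact/W'P/(lang_T_geodesic (procedure_run1 n)).
exact/W'P/Wgeo.
Qed.

Lemma procedure_haltsP : procedure_halts W WD <-> strongly_geodesically_automatic A.
Proof.
split=> [[[|n] [//= _ T0]]|[W' [M' [WM' W'P]]]].
  exact: halted_strongly_geodesically_automatic (@procedure_run_finite n) (@procedure_run_ge n) T0.
apply: contrapT => nhalt.
have Tn n : lang_T W (WD n.+1) <> set0 by move=> T0; apply: nhalt; exists n.+1.
apply: (@strictly_increasing_not_bounded (multiplier_diffs M `|` multiplier_diffs M')
  (fun n => WD n.+1)).
- by rewrite finite_setU; split; [exact: multiplier_diffs_finite WM | exact: multiplier_diffs_finite WM'].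
- by move=> n; exact: procedure_run_bounded WM' W'P.
- by move=> n; split; [exact: procedure_run_sub | exact: procedure_run_proper].
Qed.

End Halting.

Theorem theorem3p1 (G : groupType) (X : {fset G})
  (hgen : forall g : G, exists u : seq (alphabet X), ev u = g)
  (leA : rel (alphabet X))
  (leA_total : total leA) (leA_trans : transitive leA)
  (leA_anti : antisymmetric leA)
  (W : automaton (alphabet X))
  (M : G -> automaton (option (alphabet X) * option (alphabet X)))
  (hWM : shortlex_automatic_structure leA W M)
  (WD : nat -> set G) (hrun : procedure_run W M WD) :
  procedure_halts W WD <-> strongly_geodesically_automatic (alphabet X).
Proof.
have [WM Wsl] := hWM.
by apply: procedure_haltsP hrun => // u /Wsl[].
Qed.
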